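(* Let $n\geq 3$ and let $D$ be a simple strongly connected digraph on $n$ vertices which is not isomorphic to the complete digraph $\overset{\longleftrightarrow}{K_n}$ and not isomorphic to $\overrightarrow{K}(n,n-2,1)$. Then $$q(D)<\frac{3n-5+\sqrt{n^2+2n-7}}{2}.$$
   Context: Digraphs are finite and simple (no loops, no multiple arcs; opposite arcs allowed). $q(D)$ is the spectral radius of the signless Laplacian matrix $Q(D)=\mathrm{diag}(d_1^+,\ldots,d_n^+)+A(D)$, where $d_i^+$ is the outdegree of vertex $i$ and $A(D)$ is the adjacency matrix. $\overset{\longleftrightarrow}{K_n}$ is the digraph on $n$ vertices with all arcs $(i,j)$, $i\neq j$. $\overrightarrow{K}(n,n-2,1)$ is the digraph obtained from $\overset{\longleftrightarrow}{K_n}$ by deleting a single arc. *)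

(* Defs.v *)
From mathcomp Require Import all_boot all_order all_algebra.
From mathcomp Require Import all_fingroup complex.
From mathcomp Require Import boolp classical_sets reals.

Set Implicit Arguments.
Unset Strict Implicit.
Unset Printing Implicit Defensive.

Import Order.TTheory GRing.Theory Num.Theory.
Local Open Scope ring_scope.

Record digraph (n : nat) := Digraph {
  arc : rel 'I_n;
  arc_irr : irreflexive arc
}.

Definition digraph_iso (n : nat) (D1 D2 : digraph n) : Prop :=
  exists s : {perm 'I_n}, forall i j, arc D2 (s i) (s j) = arc D1 i j.

Definition strongly_connected (n : nat) (D : digraph n) : Prop :=
  forall i j : 'I_n, connect (arc D) i j.

Definition outdeg (n : nat) (D : digraph n) (i : 'I_n) : nat :=
  #|[pred j | arc D i j]|.

Lemma complete_irr (n : nat) : irreflexive (fun i j : 'I_n => i != j).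
Proof. by move=> i; rewrite eqxx. Qed.

Definition complete_digraph (n : nat) : digraph n :=
  Digraph (@complete_irr n).

(* The deleted arc is the one from vertex 0 to vertex 1.  Any other choice
   gives an isomorphic digraph.  For n <= 1 nothing is deleted. *)
Definition complete_minus_arc_rel (n : nat) : rel 'I_n :=
  fun i j => (i != j) && ~~ ((val i == 0%N) && (val j == 1%N)).

Lemma complete_minus_arc_irr (n : nat) :
  irreflexive (@complete_minus_arc_rel n).
Proof. by move=> i; rewrite /complete_minus_arc_rel eqxx. Qed.

Definition complete_minus_arc (n : nat) : digraph n :=
  Digraph (@complete_minus_arc_irr n).

Definition adjacency_mx (R : pzRingType) (n : nat) (D : digraph n) : 'M[R]_n :=
  \matrix_(i, j) (arc D i j)%:R.

Definition signless_laplacian (R : pzRingType) (n : nat) (D : digraph n) :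
    'M[R]_n :=
  diag_mx (\row_i (outdeg D i)%:R) + adjacency_mx R D.

(* The set of moduli is finite, and nonempty for n > 0, so that for n > 0 the
   supremum is a maximum.  Its elements are in R, as normc : R[i] -> R. *)
Definition spectral_radius (R : realType) (n : nat) (A : 'M[R]_n) : R :=
  sup [set ComplexField.Normc.normc z | z in
        [set z : R[i] | eigenvalue (map_mx (real_complex R) A) z]].

Definition qrad (R : realType) (n : nat) (D : digraph n) : R :=
  spectral_radius (signless_laplacian R D).

(* Main.v *)
(** The bound [b] is the Perron root of the complete digraph minus one arc
    [(a, u)], with positive eigenvector [x] equal to [b - (2n - 3)] at [a] and to
    [1] elsewhere.  As [D] misses [(a, u)] and a second arc [(c, d)], we get
    [Q(D) x <= b x], strictly in row [c].  Pairing with the moduli of a left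
    eigenvector of [Q(D)], strong connectedness excludes an eigenvalue of
    modulus at least [b]. *)
Require Import Defs.
From mathcomp Require Import all_boot all_order all_algebra.
From mathcomp Require Import reals.
From mathcomp Require Import perm complex boolp classical_sets ring lra.
Import Order.TTheory GRing.Theory Num.Theory.
Local Open Scope ring_scope.

(** The eigenvalues are roots of the characteristic polynomial, so there are finitely many, and a
    strict bound on each modulus survives the supremum. *)
Lemma spectral_radius_lt (R : realType) (n : nat) (A : 'M[R]_n) (b : R) :
  0 < b ->
  (forall z : R[i], eigenvalue (map_mx (real_complex R) A) z ->
     ComplexField.Normc.normc z < b) ->
  spectral_radius A < b.
Proof.
move=> b0 Ab; rewrite /spectral_radius; set S := (X in sup X).
have [rs rsE] := closed_field_poly_normal (char_poly (map_mx (real_complex R) A)).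
(* Filtering the roots by modulus below [b] makes the maximum less than [b] by construction; by [Ab]
   no eigenvalue is filtered out. The default value [0] is covered by [b0]. *)
have Szmax s : S s -> s <= \big[Num.max/0]_(z <- rs | ComplexField.Normc.normc z < b)
    ComplexField.Normc.normc z.
  move=> [z /= eigz <-].
  have zrs : z \in rs.
    move: eigz; rewrite eigenvalue_root_char rsE.
    by rewrite (monicP (char_poly_monic _)) scale1r root_prod_XsubC.
  by apply: (@le_bigmax_seq _ _ _ _ _ z) => //; exact: Ab.
have maxb : \big[Num.max/0]_(z <- rs | ComplexField.Normc.normc z < b)
    ComplexField.Normc.normc z < b by exact: bigmax_lt.
have [->|/set0P S0] := eqVneq S set0; first by rewrite sup0.
by apply: le_lt_trans maxb; apply: ge_sup.
Qed.

(** Triangle inequality in column [j] of the eigenvector equation, carried out in [R[i]], where the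
    norm is the embedded [normc]. *)
Lemma left_eigenvector_normc_le (R : realType) (n : nat) (A : 'M[R]_n)
    (v : 'rV[R[i]]_n) (z : R[i]) (j : 'I_n) :
  (forall i k, 0 <= A i k) ->
  v *m map_mx (real_complex R) A = z *: v ->
  ComplexField.Normc.normc z * ComplexField.Normc.normc (v 0 j) <=
    \sum_i ComplexField.Normc.normc (v 0 i) * A i j.
Proof.
move=> A0 /matrixP/(_ 0 j); rewrite !mxE => vz.
rewrite -ComplexField.Normc.normcM -vz -lecR rmorph_sum /=.
set t := \sum_i _; change (`|t| <= \sum_i real_complex R (ComplexField.Normc.normc (v 0 i) * A i j)).
apply: (le_trans (ler_norm_sum _ _ _)); apply: ler_sum => i _.
by rewrite !mxE normrM rmorphM /= (@ger0_norm _ (real_complex R (A i j)))// ler0c.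
Qed.

Lemma eigenvalue_normc_lt (R : realType) (n : nat) (A : 'M[R]_n)
    (x : 'I_n -> R) (b : R) (c : 'I_n) (z : R[i]) :
  (forall i k, 0 <= A i k) ->
  (forall i k, connect (fun i k => 0 < A i k) i k) ->
  (forall i, 0 < x i) ->
  (forall i, \sum_k A i k * x k <= b * x i) ->
  \sum_k A c k * x k < b * x c ->
  eigenvalue (map_mx (real_complex R) A) z ->
  ComplexField.Normc.normc z < b.
Proof.
move=> A0 Aconn x0 Axb Acb /eigenvalueP[v vz vN0].
rewrite ltNge; apply/negP => bz.
pose w i := ComplexField.Normc.normc (v 0 i).
have w0 i : 0 <= w i by rewrite /w; case: (v 0 i) => ? ?; exact: sqrtr_ge0.
(* [r] is the slack in [A x <= b x], and [e] the slack in [b w <= w A], which holds under the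
   assumption [b <= |z|]. *)
pose r i := b * x i - \sum_k A i k * x k.
pose e j := \sum_i w i * A i j - b * w j.
have r0 i : 0 <= r i by rewrite subr_ge0.
have e0 j : 0 <= e j.
  rewrite subr_ge0 (le_trans _ (left_eigenvector_normc_le _ _ _ _ _ j A0 vz))//.
  by rewrite ler_wpM2r.
(* Both sums are differences of [w A x] and [b w x], with opposite signs. Being nonnegative, they
   vanish term by term. *)
have re : \sum_i w i * r i + \sum_j e j * x j = 0.
  have -> : \sum_i w i * r i =
      \sum_i b * (w i * x i) - \sum_i \sum_k w i * A i k * x k.
    rewrite -sumrB; apply: eq_bigr => i _; rewrite /r mulrBr mulr_sumr mulrCA.
    by congr (_ - _); apply: eq_bigr => k _; rewrite mulrA.
  have -> : \sum_j e j * x j =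
      \sum_i \sum_k w i * A i k * x k - \sum_i b * (w i * x i).
    rewrite exchange_big -sumrB; apply: eq_bigr => j _.
    by rewrite /e mulrBl mulr_suml mulrA.
  by rewrite addrC subrKA subrr.
have wr0 : 0 <= \sum_i w i * r i by apply: sumr_ge0 => i _; rewrite mulr_ge0.
have ex0 : 0 <= \sum_j e j * x j.
  by apply: sumr_ge0 => i _; rewrite mulr_ge0// ltW.
have wri i : w i * r i = 0.
  have /psumr_eq0P : \sum_i w i * r i = 0 by lra.
  by apply => // k _; rewrite mulr_ge0.
have ei i : e i = 0.
  have /psumr_eq0P/(_ i isT)/eqP : \sum_j e j * x j = 0 by lra.
  rewrite mulf_eq0 (gt_eqF (x0 i)) orbF => E; apply/eqP/E => k _.
  by rewrite mulr_ge0// ltW.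
have wc : w c = 0.
  by move/eqP: (wri c); rewrite mulf_eq0 => /orP[/eqP//|]; rewrite gt_eqF// subr_gt0.
(* As [e k = 0], the nonnegative terms [w i * A i k] sum to [b * w k]; so a zero of [w] spreads
   backwards along positive entries, and from [c] it reaches every vertex. *)
have wpred i k : 0 < A i k -> w k = 0 -> w i = 0.
  move=> Aik wk; move: (ei k); rewrite /e wk mulr0 subr0 => /psumr_eq0P.
  move=> /(_ (fun i _ => mulr_ge0 (w0 i) (A0 i k)))/(_ i isT)/eqP.
  by rewrite mulf_eq0 (gt_eqF Aik) orbF => /eqP.
have w_eq0 i : w i = 0.
  have /connectP[p] := Aconn i c.
  elim: p i => [|k p IHp] i /=; first by move=> _ <-.
  by move=> /andP[Aik kp] cE; apply: wpred Aik _; exact: IHp.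
move/negP: vN0; apply; apply/eqP/rowP => i; rewrite mxE.
exact/ComplexField.Normc.eq0_normc/w_eq0.
Qed.

(** The diagonal entry supplies one copy of [x i] per out-neighbour of [i]. *)
Lemma signless_laplacian_mulE (R : pzRingType) (n : nat) (D : digraph n)
    (x : 'I_n -> R) (i : 'I_n) :
  \sum_k signless_laplacian R D i k * x k = \sum_(k | Defs.arc D i k) (x i + x k).
Proof.
rewrite big_split /= sumr_const -[#|_|]/(outdeg D i) -mulr_natl.
under eq_bigr => k _ do rewrite !mxE mulrDl.
rewrite big_split /=; congr (_ + _).
  rewrite (bigD1 i) //= eqxx big1 ?addr0// => k /negPf.
  by rewrite eq_sym => ->; rewrite mulr0n mul0r.
rewrite [RHS]big_mkcond; apply: eq_bigr => k _.
by case: Defs.arc; rewrite ?mul1r ?mul0r.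
Qed.

Lemma missing_arc (n : nat) (D : digraph n) :
  ~ digraph_iso D (complete_digraph n) ->
  exists a u : 'I_n, a != u /\ ~~ Defs.arc D a u.
Proof.
move=> Dc; have [/existsP[a /existsP[u /andP[]]]|] :=
  boolP [exists a, exists u, (a != u) && ~~ Defs.arc D a u]; first by exists a, u.
move/existsPn => Dall; case: Dc; exists 1%g => i j; rewrite !perm1 /=.
have := Dall i; move/existsPn/(_ j); rewrite negb_and negbK negbK.
by have [->|_ /= ->//] := eqVneq i j; rewrite arc_irr.
Qed.

Lemma second_missing_arc (n : nat) (D : digraph n) (a u : 'I_n) :
  (2 <= n)%N -> a != u -> ~~ Defs.arc D a u ->
  ~ digraph_iso D (complete_minus_arc n) ->
  exists c d : 'I_n, [/\ c != d, ~~ Defs.arc D c d & (c, d) != (a, u)].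
Proof.
move=> n2 au Dau Dm.
have [/existsP[c /existsP[d /and3P[]]]|] :=
  boolP [exists c, exists d, [&& c != d, ~~ Defs.arc D c d & (c, d) != (a, u)]].
  by exists c, d.
move/existsPn => Dall; case: Dm.
have n1 : (0 < n)%N by exact: ltnW.
pose o0 := Ordinal n1; pose o1 := Ordinal n2.
(* The first transposition sends [a] to [0]; the second sends the image of [u] to [1] and fixes [0],
   since that image is not [0]. If [(a, u)] were the only missing arc, [s] would be an
   isomorphism. *)
pose s := (tperm a o0 * tperm (tperm a o0 u) o1)%g.
have sa : s a = o0.
  rewrite permM tpermL tpermD//.
  by rewrite -{2}(tpermL a o0) (inj_eq perm_inj) eq_sym.
have su : s u = o1 by rewrite permM tpermL.
exists s => i j; rewrite /= /complete_minus_arc_rel (inj_eq perm_inj).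
have -> : (val (s i) == 0%N) = (i == a).
  by rewrite -(inj_eq (@perm_inj _ s)) sa.
have -> : (val (s j) == 1%N) = (j == u).
  by rewrite -(inj_eq (@perm_inj _ s)) su.
have := Dall i; move/existsPn/(_ j); rewrite xpair_eqE.
have [->|_] /= := eqVneq i j; first by rewrite arc_irr.
have [/andP[/eqP-> /eqP->]|_] := boolP ((i == a) && (j == u)).
  by rewrite (negPf Dau).
by rewrite andbT negbK => ->.
Qed.

Lemma card_neq2 (n : nat) (i j : 'I_n) :
  i != j -> #|[pred k | (k != i) && (k != j)]| = n.-2.
Proof.
move=> ij; have := cardsC [set i; j]; rewrite cards2 ij card_ord.
move/(congr1 (subn^~ 2)); rewrite addKn subn2 => <-.
by apply: eq_card => k; rewrite !inE negb_or.
Qed.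

(** Row [a] has [n - 2] out-neighbours, all of value [1]. Any other row has [n - 2] out-neighbours
    of value [1], contributing [2] each, and also [a], contributing [1 + al]. *)
Lemma sum_complete_minus_arc (R : realType) (n : nat) (a u i : 'I_n) (al : R) :
  a != u ->
  let x k := if k == a then al else 1 in
  \sum_(k | (i != k) && ((i, k) != (a, u))) (x i + x k) =
    if i == a then (n%:R - 2) * (al + 1) else 2 * n%:R - 3 + al.
Proof.
move=> au x.
have n2 : (n.-2)%:R = n%:R - 2 :> R.
  rewrite -subn2 natrB//.
  by have := max_card [set a; u]; rewrite cards2 au card_ord.
have sum_neq2 (j : 'I_n) : a != j ->
    \sum_(k | (k != a) && (k != j)) (x i + x k) = (n%:R - 2) * (x i + 1).
  move=> aj; rewrite -n2 -(card_neq2 _ _ _ aj) mulr_natl -sumr_const.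
  by apply: eq_bigr => k /andP[/negPf ka _]; rewrite /x ka.
have [ia|ia] := eqVneq i a.
  rewrite -[al]/(if true then al else 1) -(eqxx a) -/(x a) -ia -(sum_neq2 u)//.
  by apply: eq_bigl => k; rewrite xpair_eqE ia eqxx eq_sym.
rewrite (bigD1 a) /= ?ia ?xpair_eqE ?(negPf ia)//.
have := sum_neq2 i; rewrite eq_sym => /(_ ia) sum_i.
transitivity ((x i + x a) + (n%:R - 2) * (x i + 1)).
  congr (_ + _); rewrite -sum_i; apply: eq_bigl => k.
  by rewrite xpair_eqE (negPf ia) andbT andbC [i == k]eq_sym.
by rewrite /x eqxx (negPf ia); ring.
Qed.

Theorem theorem6p5 (R : realType) (n : nat) (D : digraph n) :
  (3 <= n)%N ->
  strongly_connected D ->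
  ~ digraph_iso D (complete_digraph n) ->
  ~ digraph_iso D (complete_minus_arc n) ->
  qrad R D < (3 * n%:R - 5 + Num.sqrt (n%:R ^+ 2 + 2 * n%:R - 7)) / 2.
Proof.
move=> n3 Dconn Dc Dm; set b := (X in _ < X).
have n3R : 3 <= n%:R :> R by rewrite ler_nat.
have [a [u [au Dau]]] := missing_arc _ _ Dc.
have [c [d [cd Dcd cdau]]] := second_missing_arc _ _ _ _ (ltnW n3) au Dau Dm.
have sqrE : Num.sqrt (n%:R ^+ 2 + 2 * n%:R - 7) ^+ 2 = n%:R ^+ 2 + 2 * n%:R - 7 :> R.
  by rewrite sqr_sqrtr//; nra.
have sqr0 := sqrtr_ge0 (n%:R ^+ 2 + 2 * n%:R - 7 : R).
(* This value solves the eigenvector equation [2n - 3 + al = b] of the rows other than [a]. Its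
   positivity means that the square root exceeds [n - 1], that is [4n > 8]. *)
pose al := b - (2 * n%:R - 3).
have al0 : 0 < al by rewrite /al /b; nra.
(* The equation of row [a]; it amounts to [b^2 - (3n - 5) b + 2 (n - 2)^2 = 0], of which [b] is the
   larger root. *)
have bal : (n%:R - 2) * (al + 1) = b * al.
  by apply/eqP; rewrite -subr_eq0; apply/eqP; rewrite /al /b; nra.
pose x (k : 'I_n) := if k == a then al else 1.
have x0 k : 0 < x k by rewrite /x; case: ifP.
have xbE i : \sum_(k | (i != k) && ((i, k) != (a, u))) (x i + x k) = b * x i.
  rewrite sum_complete_minus_arc// /x; case: ifP => // _.
  by rewrite mulr1 /al addrC subrK.
have Dsub i k : Defs.arc D i k -> (i != k) && ((i, k) != (a, u)).
  move=> Dik; apply/andP; split.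
    by apply: contraTneq Dik => ->; rewrite arc_irr.
  by apply: contraTneq Dik => -[-> ->].
(* The second sum, over arcs other than [(a, u)] missing from [D], is the slack of row [i]; in row
   [c] it contains the positive term of [d]. *)
have sumD i : b * x i = \sum_(k | Defs.arc D i k) (x i + x k) +
    \sum_(k | [&& i != k, (i, k) != (a, u) & ~~ Defs.arc D i k]) (x i + x k).
  rewrite -xbE (bigID (Defs.arc D i)) /=; congr (_ + _); apply: eq_bigl => k.
    by rewrite andb_idl// => /Dsub.
  by rewrite andbA.
have xx0 i k : 0 < x i + x k by rewrite addr_gt0.
rewrite /qrad; apply: spectral_radius_lt => [|z]; first by rewrite /b; lra.
apply: (@eigenvalue_normc_lt _ _ _ x _ c) => //.
- by move=> i k; rewrite !mxE addr_ge0// mulrn_wge0.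
- move=> i k; apply: connect_sub (Dconn i k) => {}i {}k Dik; apply: connect1.
  by rewrite !mxE Dik ltr_wpDl// mulrn_wge0.
- move=> i; rewrite signless_laplacian_mulE sumD lerDl.
  by apply: sumr_ge0 => k _; exact: ltW.
- rewrite signless_laplacian_mulE sumD ltrDl (bigD1 d) ?cd ?cdau//=.
  by rewrite ltr_pwDl// sumr_ge0// => k _; exact: ltW.
Qed.
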